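(* For every $x\in(0,1)$, the Schreier graph of the action of Thompson's group $F$ on the orbit of $x$, with respect to the generating set $\{x_0,x_1\}$, has infinitely many ends.
   Context: Thompson's group $F$ is the group of all strictly increasing piecewise linear homeomorphisms of $[0,1]$ that are differentiable except at finitely many dyadic rationals and whose slopes are integer powers of $2$; products are read left to right, $(fg)(x)=g(f(x))$, and $x^f:=f(x)$. It is generated by $x_0,x_1$, where $x_0(t)=t/2$ on $[0,\frac12]$, $t-\frac14$ on $[\frac12,\frac34]$, $2t-1$ on $[\frac34,1]$; and $x_1(t)=t$ on $[0,\frac12]$, $\frac t2+\frac14$ on $[\frac12,\frac34]$, $t-\frac18$ on $[\frac34,\frac78]$, $2t-1$ on $[\frac78,1]$. The Schreier graph of the action of $F$ on the orbit of $x$ has the points of the orbit as vertices, with a directed edge labeled $s\in\{x_0,x_1\}$ from $y$ to $z$ iff $y^s=z$. The number of ends of a graph $Y$ is the supremum of the number of unbounded connected components of $Y-C$, where $C$ runs over all finite subgraphs of $Y$ (orientation of edges is ignored). *)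

(* Defs.v *)
From HB Require Import structures.
From mathcomp Require Import all_boot all_order all_algebra.
From mathcomp Require Import all_classical all_reals all_analysis.

Set Implicit Arguments.
Unset Strict Implicit.
Unset Printing Implicit Defensive.

Import Order.TTheory GRing.Theory Num.Theory.
Import numFieldNormedType.Exports.

Local Open Scope classical_set_scope.
Local Open Scope ring_scope.

Record digraph := Digraph {
  vertex : Type;
  arrow : Type;
  source : arrow -> vertex;
  target : arrow -> vertex }.

Record subgraph (Y : digraph) := Subgraph {
  subvertex : set (vertex Y);
  subarrow : set (arrow Y);
  subgraphP : forall e, subarrow e ->
    subvertex (source e) /\ subvertex (target e) }.

Definition finite_subgraph (Y : digraph) (C : subgraph Y) : Prop :=
  finite_set (subvertex C) /\ finite_set (subarrow C).

(* The orientation of arrows is ignored. *)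
Definition joins (Y : digraph) (e : arrow Y) (u v : vertex Y) : Prop :=
  (source e = u /\ target e = v) \/ (source e = v /\ target e = u).

Definition adjacent (Y : digraph) (u v : vertex Y) : Prop :=
  exists e, joins e u v.

(* Adjacency in Y - C. *)
Definition adjacent_off (Y : digraph) (C : subgraph Y) (u v : vertex Y) :
    Prop :=
  [/\ ~ subvertex C u, ~ subvertex C v &
      exists2 e, ~ subarrow C e & joins e u v].

Inductive walk (V : Type) (adj : V -> V -> Prop) : nat -> V -> V -> Prop :=
| walk_nil u : walk adj 0 u u
| walk_cons n u v w : adj u v -> walk adj n v w -> walk adj n.+1 u w.

Definition component_off (Y : digraph) (C : subgraph Y) (u : vertex Y) :
    set (vertex Y) :=
  [set v | exists n, walk (@adjacent_off Y C) n u v].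

Definition components_off (Y : digraph) (C : subgraph Y) :
    set (set (vertex Y)) :=
  [set component_off C u | u in ~` subvertex C].

Definition dist_le (Y : digraph) (n : nat) (u v : vertex Y) : Prop :=
  exists2 m, (m <= n)%N & walk (@adjacent Y) m u v.

(* Distances are measured in Y; in a locally finite graph, measuring them in
   Y - C instead gives the same unbounded components. *)
Definition unbounded (Y : digraph) (K : set (vertex Y)) : Prop :=
  forall n, exists u v, [/\ K u, K v & ~ dist_le n u v].

(* [counting S] is the cardinality of [S], or +oo if [S] is infinite. *)
Definition number_of_ends (R : realType) (Y : digraph) : \bar R :=
  ereal_sup [set @counting _ R (components_off C `&` @unbounded Y)
            | C in @finite_subgraph Y].

Definition schreier_graph (X S : Type) (act : X -> S -> X) (O : set X) :
    digraph :=
  @Digraph (set_type O)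
    {e : set_type O * S * set_type O | act (val e.1.1) e.1.2 = val e.2}
    (fun e => (sval e).1.1) (fun e => (sval e).2).

Section Thompson.
Variable R : realType.
Implicit Types (f g : R -> R) (t : R).

(* A self-map of [0, 1] is represented by a function R -> R, whose values
   outside [0, 1] are irrelevant. *)
Definition homeomorphism01 f : Prop :=
  exists g, [/\ set_fun `[0, 1] `[0, 1] f, set_fun `[0, 1] `[0, 1] g,
    {in `[0, 1], cancel f g} /\ {in `[0, 1], cancel g f},
    {within `[0, 1], continuous f} & {within `[0, 1], continuous g}].

Definition increasing01 f : Prop :=
  {in `[0, 1] &, {homo f : s t / s < t}}.

Definition dyadic t : Prop := exists (m : int) (k : nat), t = m%:~R / 2 ^+ k.

(* [f] is affine on each closed subinterval of [0, 1] having no element of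
   [bp] in its interior. *)
Definition piecewise_linear01 (bp : seq R) f : Prop :=
  forall a b, 0 <= a -> a < b -> b <= 1 ->
    (forall t, t \in bp -> t \notin `]a, b[) ->
    exists c d, {in `[a, b], forall t, f t = c * t + d}.

Definition thompsonF : set (R -> R) :=
  [set f | [/\ homeomorphism01 f, increasing01 f &
    exists bp : seq R, [/\ {in bp, forall t, dyadic t},
      piecewise_linear01 bp f &
      forall t, t \in `]0, 1[ -> t \notin bp ->
        exists k : int, is_derive t 1 f (2 ^ k)]]].

Definition orbitF t : set R := [set f t | f in thompsonF].

Definition x0 t : R :=
  if t <= 1 / 2 then t / 2
  else if t <= 3 / 4 then t - 1 / 4
  else 2 * t - 1.

Definition x1 t : R :=
  if t <= 1 / 2 then t
  else if t <= 3 / 4 then t / 2 + 1 / 4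
  else if t <= 7 / 8 then t - 1 / 8
  else 2 * t - 1.

(* Products in F being read from left to right, y^s is the value of s at y. *)
Variant generator := X0 | X1.

Definition act_gen t (s : generator) : R :=
  match s with X0 => x0 t | X1 => x1 t end.

Definition schreierF t : digraph := schreier_graph act_gen (orbitF t).

End Thompson.

(* Main.v *)
Require Import Defs.
From mathcomp Require Import all_boot all_order all_algebra.
From mathcomp Require Import all_classical all_reals all_analysis.
From mathcomp Require Import ring lra.

Set Implicit Arguments.
Unset Strict Implicit.
Unset Printing Implicit Defensive.

Import Order.TTheory GRing.Theory Num.Theory.
Import numFieldNormedType.Exports.

Local Open Scope classical_set_scope.
Local Open Scope ring_scope.

(** The Schreier graph is a tree-like core with rays hanging from it, and each
ray can be cut off by deleting a single vertex.

On [(0, 1/2]] the generator [x1] is the identity and [x0] is division by [2].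
Hence, for a point [b] of the orbit with [1/4 < b <= 1/2], the points
[b / 2 ^ k] with [k > 0] form a ray: their edges are the loops labelled [x1],
the edges labelled [x0] along the ray, and a single further edge joining
[b / 2] to [b].  Once [b] is deleted, this ray is a connected component
([ray_component], [ray_connected]).  It is unbounded because both generators
and their inverses at most halve a positive number, so that a walk of [m]
steps starting at [u] cannot end below [u / 2 ^ m] ([walk_contraction]).

The orbit has infinitely many points in [(1/4, 1/2]].  Applying powers of [x0]
to [x] leads to a point [1/2 + d] with [0 < d <= 1/4] ([reach_mid]); there [x1]
halves [d], so all [1/2 + d / 2 ^ i] are in the orbit, and [x0] sends them to
the distinct points [1/4 + d / 2 ^ i] ([reach_ray]).  Deleting the first [n] of
these leaves at least [n] unbounded components, for every [n].

That these points are in the orbit rests on [x0] and [x1] generating a subgroup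
of F.  The closure under composition and inversion is proved for the
homeomorphisms [dyadic_homeo] of the whole real line, whose elements restrict
to elements of F ([dyadic_homeo_thompson]). *)

(** * Dyadic numbers *)

Section Dyadic.
Variable R : realType.
Implicit Types s t : R.

Lemma dyadic_int (m : int) : dyadic (m%:~R : R).
Proof. by exists m, 0; rewrite expr0 divr1. Qed.

Lemma dyadic_half t : dyadic t -> dyadic (t / 2).
Proof.
by move=> [m [k ->]]; exists m, k.+1; rewrite exprSr invfM -mulrA.
Qed.

Lemma dyadicD s t : dyadic s -> dyadic t -> dyadic (s + t).
Proof.
move=> [m [k ->]] [n [l ->]].
exists (m * 2 ^+ l + n * 2 ^+ k), (k + l)%N.
have p2 j : (2 : R) ^+ j != 0 by rewrite expf_neq0.
by rewrite rmorphD !rmorphM !rmorphXn /= exprD; field; rewrite !p2.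
Qed.

Lemma dyadicN t : dyadic t -> dyadic (- t).
Proof.
by move=> [m [k ->]]; exists (- m), k; rewrite rmorphN mulNr.
Qed.

Lemma dyadic_halfE t : dyadic (t / 2) <-> dyadic t.
Proof.
split=> [h|]; last exact: dyadic_half.
have tE: t / 2 + t / 2 = t by field.
by rewrite -tE; apply: (dyadicD h h).
Qed.

Lemma dyadic_doubleE t : dyadic (2 * t) <-> dyadic t.
Proof. by rewrite -dyadic_halfE mulrC mulKf. Qed.

Lemma dyadic_shiftE s t : dyadic s -> dyadic (t + s) <-> dyadic t.
Proof.
move=> ds; split=> h; last exact: dyadicD.
have tE : t + s - s = t by lra.
by rewrite -tE; exact: dyadicD h (dyadicN ds).
Qed.

Lemma dyadic1 : dyadic (1 : R).
Proof. exact: (dyadic_int 1). Qed.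

Lemma dyadic_quarters (m : int) : dyadic (m%:~R / 4 : R).
Proof. by exists m, 2%N; congr (_ / _); ring. Qed.

Lemma dyadic_eighths (m : int) : dyadic (m%:~R / 8 : R).
Proof. by exists m, 3%N; congr (_ / _); ring. Qed.

End Dyadic.

(** * A group of piecewise linear homeomorphisms of the line *)

Section DyadicHomeo.
Variable R : realType.
Implicit Types f g : R -> R.

(** The slope condition is put on whole affine pieces rather than on derivatives
at points: in this form it passes to composites and inverses by computing with
affine maps alone. *)
Definition dyadic_pieces f : Prop :=
  exists bp : seq R, {in bp, forall t, dyadic t} /\
    forall a b, a < b -> (forall t, t \in bp -> t \notin `]a, b[) ->
      exists (k : int) (d : R), {in `[a, b], forall t, f t = 2 ^ k * t + d}.

(** Elements of F extended to the line.  Bijectivity on all of [R] avoids any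
bookkeeping of domains.  Preservation of dyadic numbers in both directions is
what keeps the breakpoints of composites and inverses dyadic. *)
Record dyadic_homeo f : Prop := DyadicHomeo {
  dyadic_homeo0 : f 0 = 0;
  dyadic_homeo1 : f 1 = 1;
  dyadic_homeo_bij : bijective f;
  dyadic_homeo_lt : {mono f : s t / s < t};
  dyadic_homeo_dyadic : forall t, dyadic (f t) <-> dyadic t;
  dyadic_homeo_pieces : dyadic_pieces f }.

Lemma dyadic_homeo_le f : dyadic_homeo f -> {mono f : s t / s <= t}.
Proof. by move=> /dyadic_homeo_lt flt s t; rewrite !leNgt flt. Qed.

Lemma dyadic_homeo_id : dyadic_homeo id.
Proof.
split=> //; first by exists id.
by exists [::]; split=> // a b _ _; exists 0, 0 => t _; rewrite expr0z; ring.
Qed.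

Lemma dyadic_homeo_comp f g :
  dyadic_homeo f -> dyadic_homeo g -> dyadic_homeo (g \o f).
Proof.
move=> hf hg; have [fi fK fiK] := dyadic_homeo_bij hf.
split=> /=.
- by rewrite (dyadic_homeo0 hf) (dyadic_homeo0 hg).
- by rewrite (dyadic_homeo1 hf) (dyadic_homeo1 hg).
- exact: bij_comp (dyadic_homeo_bij hg) (dyadic_homeo_bij hf).
- by move=> s t /=; rewrite (dyadic_homeo_lt hg) (dyadic_homeo_lt hf).
- by move=> t; rewrite (dyadic_homeo_dyadic hg) (dyadic_homeo_dyadic hf).
(* The composite can only break where [f] does or where [f] reaches a
   breakpoint of [g]. *)
have [bf [dbf pf]] := dyadic_homeo_pieces hf.
have [bg [dbg pg]] := dyadic_homeo_pieces hg.
exists (bf ++ map fi bg); split=> [t|a b ab nobp].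
  rewrite mem_cat => /orP[/dbf//|/mapP[u /dbg du ->]].
  by rewrite -(dyadic_homeo_dyadic hf) fiK.
have [|k [d fE]] := pf a b ab.
  by move=> t tb; apply: nobp; rewrite mem_cat tb.
have [||l [e gE]] := pg (f a) (f b).
- by rewrite (dyadic_homeo_lt hf).
- move=> t tb; have := nobp (fi t).
  rewrite mem_cat map_f// orbT => /(_ isT).
  by rewrite !in_itv/= -(dyadic_homeo_lt hf) -[X in _ && X](dyadic_homeo_lt hf) fiK.
exists (l + k), (2 ^ l * d + e) => t tab.
rewrite /= gE; last by move: tab; rewrite !in_itv/= !(dyadic_homeo_le hf).
by rewrite fE// expfzDr//; ring.
Qed.

Lemma dyadic_homeo_inv f g : cancel f g -> cancel g f ->
  dyadic_homeo f -> dyadic_homeo g.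
Proof.
move=> fK gK hf.
have gle : {mono g : s t / s <= t}.
  by move=> s t; rewrite -(dyadic_homeo_le hf) !gK.
split.
- by rewrite -{1}(dyadic_homeo0 hf) fK.
- by rewrite -{1}(dyadic_homeo1 hf) fK.
- by exists f.
- by move=> s t; rewrite -(dyadic_homeo_lt hf) !gK.
- by move=> t; rewrite -(dyadic_homeo_dyadic hf) gK.
have [bp [dbp pf]] := dyadic_homeo_pieces hf.
exists (map f bp); split=> [t /mapP[u /dbp du ->]|a b ab nobp].
  by rewrite (dyadic_homeo_dyadic hf).
have [||k [d fE]] := pf (g a) (g b).
- by rewrite -(dyadic_homeo_lt hf) !gK.
- move=> t tb; have := nobp (f t) (map_f f tb).
  by rewrite !in_itv/= -{1}[a]gK -{1}[b]gK !(dyadic_homeo_lt hf).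
exists (- k), (- 2 ^ (- k) * d) => t tab.
have := fE (g t); rewrite gK => tE; rewrite {2}tE; last first.
  by move: tab; rewrite !in_itv/= !gle.
have p2 : (2 : R) ^ (- k) * 2 ^ k = 1 by rewrite -expfzDr// addNr expr0z.
by rewrite mulrDr mulrA p2; ring.
Qed.

(** Turns a point that is not a breakpoint into an interval without breakpoints,
on which the affine formula gives the derivative. *)
Lemma seq_gap (s : seq R) (t : R) : t \notin s ->
  exists2 e, 0 < e & forall u, u \in s -> u \notin `]t - e, t + e[.
Proof.
elim: s => [|v s ih]; first by exists 1.
rewrite inE negb_or => /andP[tv /ih[e e0 he]].
exists (Num.min e `|t - v|).
  by rewrite lt_min e0 normr_gt0 subr_eq0.
have me : Num.min e `|t - v| <= e by rewrite ge_min lexx.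
have mv : Num.min e `|t - v| <= `|t - v| by rewrite ge_min lexx orbT.
move=> u; rewrite inE => /predU1P[->|/he]; rewrite !in_itv/=.
  by apply/negP; move: mv; case: (ger0P (t - v)) => ? ? /andP[]; lra.
by apply: contra => /andP[? ?]; apply/andP; split; lra.
Qed.

(** Continuity comes for free, since increasing surjections between segments are
continuous. *)
Lemma dyadic_homeo_thompson f : dyadic_homeo f -> thompsonF f.
Proof.
have into g : dyadic_homeo g -> set_fun `[0, 1] `[0, 1] g.
  move=> hg t /=; rewrite !in_itv/= -{2}(dyadic_homeo0 hg) -{2}(dyadic_homeo1 hg).
  by rewrite !(dyadic_homeo_le hg).
have cont g : dyadic_homeo g -> {within `[0, 1], continuous g}.
  move=> hg; apply: segment_inc_surj_continuous.
    by move=> s t _ _; exact: dyadic_homeo_le.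
  rewrite (dyadic_homeo0 hg) (dyadic_homeo1 hg) => t t01.
  have [gi gK giK] := dyadic_homeo_bij hg.
  exists (gi t); last exact: giK.
  exact: (into _ (dyadic_homeo_inv gK giK hg)).
move=> hf; have [g fK gK] := dyadic_homeo_bij hf.
have hg := dyadic_homeo_inv fK gK hf.
split.
- exists g; split; [exact: into|exact: into| |exact: cont|exact: cont].
  by split=> t _.
- by move=> s t _ _; rewrite (dyadic_homeo_lt hf).
have [bp [dbp pf]] := dyadic_homeo_pieces hf.
exists bp; split=> // [a b _ ab _ nobp|t _ /seq_gap[e e0 he]].
  by have [k [d fE]] := pf a b ab nobp; exists (2 ^ k), d.
have [|k [d fE]] := pf (t - e) (t + e) _ he; first lra.
have affE : \forall u \near t, 2 ^ k * u + d = f u.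
  near=> u; rewrite fE// in_itv/=.
  have : `|t - u| < e by near: u; exact: nbhsx_ballx.
  by rewrite ltr_norml => /andP[? ?]; apply/andP; split; lra.
exists k; apply: near_eq_is_derive affE _.
have -> : (fun u : R => 2 ^ k * u + d) = ((2 : R) ^ k) \*: (@id R) + cst d by [].
by apply: is_derive_eq; rewrite addr0 /GRing.scale/= mulr1.
Unshelve. all: by end_near.
Qed.

End DyadicHomeo.

(** * The generators and the orbit *)

Section Generators.
Variable R : realType.
Implicit Types (a b c s t d x : R).

Lemma itv_avoid a b c : c \notin `]a, b[ -> (b <= c) || (c <= a).
Proof. by rewrite in_itv/= negb_and -!leNgt orbC. Qed.

Lemma dyadic_homeo_x0 : dyadic_homeo (@x0 R).
Proof.
split.
- by rewrite /x0; case: ifP; lra.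
- by rewrite /x0; case: ifP => ?; [|case: ifP]; lra.
- exists (fun t => if t <= 1 / 4 then 2 * t
                   else if t <= 1 / 2 then t + 1 / 4 else (t + 1) / 2).
    move=> t; rewrite /x0; case: (lerP t (1 / 2)) => ?.
      by case: ifP; lra.
    case: (lerP t (3 / 4)) => ?; case: ifP; try lra;
      by case: ifP; lra.
  move=> t; case: (lerP t (1 / 4)) => ?.
    by rewrite /x0; case: ifP; lra.
  case: (lerP t (1 / 2)) => ?; rewrite /x0; case: ifP; try lra;
    by case: ifP; lra.
- apply/leW_mono/le_mono => s t st; rewrite /x0; case: (lerP s (1 / 2)) => ?; case: (lerP t (1 / 2)) => ?;
    try case: (lerP s (3 / 4)) => ?; try case: (lerP t (3 / 4)) => ?;
    by lra.
- move=> t; rewrite /x0; case: ifP => _; first exact: dyadic_halfE.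
  case: ifP => _.
    by apply: dyadic_shiftE; apply: dyadicN; exact: (dyadic_quarters _ 1).
  rewrite dyadic_shiftE; first exact: dyadic_doubleE.
  exact/dyadicN/dyadic1.
exists [:: 1 / 2; 3 / 4]; split=> [t|a b ab nobp].
  rewrite !inE => /orP[] /eqP ->; first exact/dyadic_half/dyadic1.
  exact: (dyadic_quarters _ 3).
have /itv_avoid/orP[b2|a2] : 1 / 2 \notin `]a, b[ by apply: nobp; rewrite mem_head.
  exists (-1), 0 => t; rewrite in_itv/= => /andP[? ?].
  by rewrite exprN1 /x0; case: ifP; lra.
have /itv_avoid/orP[b4|a4] : 3 / 4 \notin `]a, b[.
- by apply: nobp; rewrite !inE eqxx orbT.
- exists 0, (- (1 / 4)) => t; rewrite in_itv/= => /andP[? ?].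
  by rewrite expr0z /x0; case: ifP => ?; [|case: ifP]; lra.
- exists 1, (- 1) => t; rewrite in_itv/= => /andP[? ?].
  by rewrite expr1z /x0; case: ifP => ?; [|case: ifP]; lra.
Qed.

Lemma dyadic_homeo_x1 : dyadic_homeo (@x1 R).
Proof.
split.
- by rewrite /x1; case: ifP; lra.
- by rewrite /x1; case: ifP => ?; [|case: ifP => ?; [|case: ifP]]; lra.
- exists (fun t => if t <= 1 / 2 then t else if t <= 5 / 8 then 2 * t - 1 / 2
                   else if t <= 3 / 4 then t + 1 / 8 else (t + 1) / 2).
    move=> t; rewrite /x1; case: (lerP t (1 / 2)) => ?.
      by case: ifP; lra.
    case: (lerP t (3 / 4)) => ?; [|case: (lerP t (7 / 8)) => ?];
      case: ifP; try lra;
      case: ifP; try lra;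
      by case: ifP; lra.
  move=> t; case: (lerP t (1 / 2)) => ?.
    by rewrite /x1; case: ifP; lra.
  case: (lerP t (5 / 8)) => ?; [|case: (lerP t (3 / 4)) => ?];
    rewrite /x1; case: ifP; try lra;
    case: ifP; try lra;
    by case: ifP; lra.
- apply/leW_mono/le_mono => s t st; rewrite /x1; case: (lerP s (1 / 2)) => ?; case: (lerP t (1 / 2)) => ?;
    try (case: (lerP s (3 / 4)) => ?; try case: (lerP s (7 / 8)) => ?);
    try (case: (lerP t (3 / 4)) => ?; try case: (lerP t (7 / 8)) => ?);
    by lra.
- move=> t; rewrite /x1; case: ifP => // _; case: ifP => _.
    rewrite dyadic_shiftE; first exact: dyadic_halfE.
    exact: (dyadic_quarters _ 1).
  case: ifP => _.
    by apply: dyadic_shiftE; apply: dyadicN; exact: (dyadic_eighths _ 1).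
  rewrite dyadic_shiftE; first exact: dyadic_doubleE.
  exact/dyadicN/dyadic1.
exists [:: 1 / 2; 3 / 4; 7 / 8]; split=> [t|a b ab nobp].
  rewrite !inE => /or3P[] /eqP ->; first exact/dyadic_half/dyadic1.
    exact: (dyadic_quarters _ 3).
  exact: (dyadic_eighths _ 7).
have /itv_avoid/orP[b2|a2] : 1 / 2 \notin `]a, b[ by apply: nobp; rewrite mem_head.
  exists 0, 0 => t; rewrite in_itv/= => /andP[? ?].
  by rewrite expr0z /x1; case: ifP; lra.
have /itv_avoid/orP[b4|a4] : 3 / 4 \notin `]a, b[.
- by apply: nobp; rewrite !inE eqxx orbT.
- exists (-1), (1 / 4) => t; rewrite in_itv/= => /andP[? ?].
  by rewrite exprN1 /x1; case: ifP => ?; [|case: ifP]; lra.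
have /itv_avoid/orP[b8|a8] : 7 / 8 \notin `]a, b[.
- by apply: nobp; rewrite !inE eqxx !orbT.
- exists 0, (- (1 / 8)) => t; rewrite in_itv/= => /andP[? ?].
  by rewrite expr0z /x1; case: ifP => ?; [|case: ifP => ?; [|case: ifP]]; lra.
- exists 1, (- 1) => t; rewrite in_itv/= => /andP[? ?].
  by rewrite expr1z /x1; case: ifP => ?; [|case: ifP => ?; [|case: ifP]]; lra.
Qed.

(** The part of the orbit under F reached by the homeomorphisms [dyadic_homeo];
since these form a group, it can be moved around in by [x0], [x1] and their
inverses. *)
Definition reach x t : Prop := exists2 f, dyadic_homeo f & f x = t.

Lemma reach_orbit x t : reach x t -> orbitF x t.
Proof. by move=> [f /dyadic_homeo_thompson Ff <-]; exists f. Qed.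

Lemma reach_refl x : reach x x.
Proof. by exists id => //; exact: dyadic_homeo_id. Qed.

Lemma reach_homeo (f : R -> R) x t : dyadic_homeo f -> reach x (f t) <-> reach x t.
Proof.
move=> hf; split=> -[h hh hE].
  have [g fK gK] := dyadic_homeo_bij hf.
  exists (g \o h); last by rewrite /= hE fK.
  exact/(dyadic_homeo_comp hh)/(dyadic_homeo_inv fK gK).
by exists (f \o h); [exact: dyadic_homeo_comp|rewrite /= hE].
Qed.

Lemma x0_low t : t <= 1 / 2 -> x0 t = t / 2.
Proof. by rewrite /x0 => ->. Qed.

Lemma x0_mid d : 0 < d <= 1 / 4 -> x0 (1 / 2 + d) = 1 / 4 + d.
Proof. by rewrite /x0; case: ifP => ?; [|case: ifP]; lra. Qed.

Lemma x0_high t : 3 / 4 <= t -> x0 t = 2 * t - 1.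
Proof. by rewrite /x0; case: ifP => ?; [|case: ifP]; lra. Qed.

Lemma x1_mid d : 0 < d <= 1 / 4 -> x1 (1 / 2 + d) = 1 / 2 + d / 2.
Proof. by rewrite /x1; case: ifP => ?; [|case: ifP]; lra. Qed.

(** Below [1/2] the inverse of [x0] doubles [t] until [t] exceeds [1/4], and then
moves it above [1/2]. *)
Lemma reach_mid_low x n t : reach x t -> 1 / 4 / 2 ^+ n < t <= 1 / 2 ->
  exists2 d, 0 < d <= 1 / 4 & reach x (1 / 2 + d).
Proof.
have hx0 := dyadic_homeo_x0.
elim: n t => [|n ih] t rt /andP[tn t2];
  (have [t4|t4] := ltrP (1 / 4) t; first by
    exists (t - 1 / 4); [lra|rewrite -(reach_homeo _ _ hx0) x0_mid;
      [rewrite addrC subrK|lra]]).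
  by move: tn; rewrite expr0; lra.
apply: (ih (2 * t)).
  rewrite -(reach_homeo _ _ hx0) x0_low; last by lra.
  by rewrite (_ : 2 * t / 2 = t)//; lra.
by move: tn; rewrite exprSr invfM mulrA; lra.
Qed.

(** Above [3/4] the map [x0] doubles the distance to [1]. *)
Lemma reach_mid_high x n t : reach x t -> 1 / 2 < t -> 1 / 4 / 2 ^+ n < 1 - t ->
  exists2 d, 0 < d <= 1 / 4 & reach x (1 / 2 + d).
Proof.
have hx0 := dyadic_homeo_x0.
elim: n t => [|n ih] t rt t2 tn.
  exists (t - 1 / 2); first by move: tn; rewrite expr0; lra.
  by rewrite addrC subrK.
have [t4|t4] := lerP t (3 / 4).
  by exists (t - 1 / 2); [lra|rewrite addrC subrK].
apply: (ih (2 * t - 1)); last by move: tn; rewrite exprSr invfM mulrA; lra.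
  by rewrite -x0_high; [rewrite (reach_homeo _ _ hx0)|lra].
by lra.
Qed.

Lemma lt_invX2 c e : 0 < e -> exists n, c / 2 ^+ n < e.
Proof.
move=> e0; have [c0|c0] := ltrP c 0.
  by exists 0; rewrite expr0 divr1; lra.
exists (Num.bound (c / e)); rewrite ltr_pdivrMr ?exprn_gt0// mulrC -ltr_pdivrMr//.
apply: lt_trans (archi_boundP _) _; first by rewrite divr_ge0// ltW.
by rewrite -natrX ltr_nat ltn_expl.
Qed.

Lemma reach_mid x : 0 < x < 1 -> exists2 d, 0 < d <= 1 / 4 & reach x (1 / 2 + d).
Proof.
move=> /andP[x0 x1]; have [x2|x2] := lerP x (1 / 2).
  have [n nx] := lt_invX2 (1 / 4) x0.
  by apply: (reach_mid_low (n := n) (reach_refl x)); rewrite nx.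
have [|n nx] := @lt_invX2 (1 / 4) (1 - x); first by lra.
exact: (reach_mid_high (n := n) (reach_refl x)).
Qed.

Lemma powV2_bounds n : 0 < ((2 : R) ^+ n)^-1 <= 1.
Proof.
by rewrite invr_gt0 exprn_gt0//= invf_le1 ?exprn_gt0// exprn_ege1// ler1n.
Qed.

(** In three moves: [x1] brings [1/2 + d] to [1/2 + d / 2 ^ i], one [x0] shifts
it to [1/4 + d / 2 ^ i], and further applications of [x0] divide it by [2]. *)
Lemma reach_ray x d i k : 0 < d <= 1 / 4 -> reach x (1 / 2 + d) ->
  reach x ((1 / 4 + d / 2 ^+ i) / 2 ^+ k).
Proof.
move=> d4 rd.
have di j : 0 < d / 2 ^+ j <= 1 / 4.
  by have := powV2_bounds j; nra.
elim: k => [|k ih].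
  rewrite expr0 divr1 -x0_mid// (reach_homeo _ _ dyadic_homeo_x0).
  elim: i => [|i ih]; first by rewrite expr0 divr1.
  by rewrite exprSr invfM mulrA -x1_mid// (reach_homeo _ _ dyadic_homeo_x1).
rewrite exprSr invfM mulrA -x0_low ?(reach_homeo _ _ dyadic_homeo_x0)//.
by have := di i; have := powV2_bounds k; nra.
Qed.

End Generators.

(** * Counting ends *)

Section Graph.
Variable Y : digraph.

Lemma walk_invariant (V : Type) (adj : V -> V -> Prop) (S : set V) n u v :
  (forall w z, S w -> adj w z -> S z) -> walk adj n u v -> S u -> S v.
Proof.
by move=> Sadj; elim=> {n u v} // n u v w /[swap] _ /[swap] ih uv Su; apply/ih/Sadj/uv.
Qed.

Lemma number_of_ends_pinfty (R : realType) :
  (forall n, exists2 C : subgraph Y, finite_subgraph C &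
     exists2 K : nat -> set (vertex Y), set_inj `I_n K &
       forall i, (i < n)%N -> components_off C (K i) /\ unbounded (K i)) ->
  number_of_ends R Y = +oo%E.
Proof.
move=> ends; apply/eqyP => r r0.
have [C finC [K Kinj KC]] := ends (Num.bound r).
apply: le_trans (ereal_sup_ubound (ex_intro2 _ _ C finC erefl)).
apply: (@le_trans _ _ (Num.bound r)%:R%:E).
  by rewrite lee_fin ltW// archi_boundP// ltW.
have leK : (`I_(Num.bound r) #<= components_off C `&` @unbounded Y)%card.
  have := inj_card_eq Kinj; rewrite card_eq_le => /andP[_ leK].
  apply: card_le_trans leK (subset_card_le _) => _ [i /KC[Ki Kiu] <-] //.
rewrite /counting; case: asboolP => [fin|_]; last exact: leey.
by rewrite lee_fin ler_nat leq_card_fset_set.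
Qed.

End Graph.

(** * Rays of the Schreier graph *)

Section Schreier.
Variables (R : realType) (x : R).
Implicit Types (t d : R).
Notation V := (vertex (schreierF x)).
Notation coord v := (set_val (v : V)).

Lemma schreier_joins (e : arrow (schreierF x)) (u v : V) : joins e u v ->
  exists s, act_gen (coord u) s = coord v \/ act_gen (coord v) s = coord u.
Proof.
by case: e => -[[a s] b] /= ab; case=> -[/= <- <-]; exists s; [left|right].
Qed.

Lemma schreier_adjacent (s : generator) (u v : V) :
  act_gen (coord u) s = coord v -> exists e : arrow (schreierF x), joins e u v.
Proof. by move=> uv; exists (exist _ (u, s, v) uv); left. Qed.

(** The slopes of [x0] and [x1] lie between [1/2] and [2], and both maps fix [0];
so a step of the graph at most halves a positive point. *)
Lemma walk_contraction n (u v : V) : 0 < coord u ->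
  walk (@Defs.adjacent (schreierF x)) n u v -> coord u / 2 ^+ n <= coord v.
Proof.
move=> + uv; elim: uv => {n u v} [u _|n u v w [e /schreier_joins[s uv]] _ ih u0].
  by rewrite expr0 divr1.
have uv2 : coord u / 2 <= coord v.
  move: uv; case: s => /=; rewrite /x0 /x1 => -[];
    case: ifP => ?; try (case: ifP => ?; try case: ifP => ?); lra.
have v0 : 0 < coord v by lra.
by apply: le_trans (ih v0); rewrite exprS invfM mulrA ler_pM2r.
Qed.

Variables (p : nat -> nat -> V) (d : R).
Hypothesis d4 : 0 < d <= 1 / 4.
Hypothesis pE : forall i k, coord (p i k) = (1 / 4 + d / 2 ^+ i) / 2 ^+ k.

(** [p i k] is the [k]-th vertex of the [i]-th ray; deleting the bases [p i 0]
detaches the rays from the rest of the graph. *)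
Definition ray_cut n : subgraph (schreierF x) :=
  @Subgraph (schreierF x) [set p i 0 | i in `I_n] set0 (fun _ => False_ind _).

Lemma base_bounds i : 1 / 4 < 1 / 4 + d / 2 ^+ i <= 1 / 2.
Proof.
have : 0 < d / 2 ^+ i <= 1 / 4 by have := powV2_bounds R i; move: d4; nra.
by lra.
Qed.

Lemma ray_le i k : coord (p i k.+1) <= 1 / 4.
Proof.
rewrite pE exprS; have := powV2_bounds R k; have := base_bounds i.
by rewrite invfM; nra.
Qed.

Lemma ray_cutN n i k : ~ subvertex (ray_cut n) (p i k.+1).
Proof.
move=> -[j _ pj]; have := ray_le i k; rewrite -pj pE expr0 divr1.
by have := base_bounds j; lra.
Qed.

Lemma ray_step i k : act_gen (coord (p i k)) X0 = coord (p i k.+1).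
Proof.
rewrite /= x0_low ?pE; first by rewrite exprSr invfM mulrA.
by have := base_bounds i; have := powV2_bounds R k; nra.
Qed.

Lemma ray_connected n i k j :
  walk (adjacent_off (ray_cut n)) k (p i j.+1) (p i (j + k).+1).
Proof.
elim: k j => [|k ih] j; first by rewrite addn0; exact: walk_nil.
apply: (walk_cons _ (v := p i j.+2)); last by rewrite -addSnnS; exact: ih.
split; [exact: ray_cutN|exact: ray_cutN|].
by have [e ?] := schreier_adjacent (ray_step i j.+1); exists e.
Qed.

(** The only edge leaving the ray without its base leads to the base. *)
Lemma ray_component n i : (i < n)%N ->
  component_off (ray_cut n) (p i 1) `<=` [set p i k.+1 | k in setT].
Proof.
move=> ni v [m pv]; apply: walk_invariant pv _; last by exists 0.
move=> _ {}v [k _ <-] [_ vC [e _ /schreier_joins[s ev]]].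
have vinj (w z : V) : coord w = coord z -> w = z by exact: val_inj.
have := ray_le i k; set w := p i k.+1 in ev * => w4.
have : coord v = coord w \/ coord v = coord w / 2 \/ coord v = coord w * 2.
  move: ev; case: s => /=; rewrite /x0 /x1 => -[];
    case: ifP => ?; try (case: ifP => ?; try case: ifP => ?); lra.
case=> [/vinj->|[vw|vw]]; first by exists k.
  exists k.+1 => //; apply: vinj.
  by rewrite vw /w !pE (exprSr _ k.+1) invfM mulrA.
have vE : v = p i k.
  by apply: vinj; rewrite vw /w !pE exprSr invfM mulrA mulfVK.
case: k vE {w w4 vw ev} => [vE|k ->]; last by exists k.
by case: vC; exists i.
Qed.

(** A walk of at most [m] steps from [b / 2] stays above [b / 2 ^ m.+2], which is
the coordinate of the vertex [p i m.+2] of the same component. *)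
Lemma ray_unbounded n i : @unbounded (schreierF x) (component_off (ray_cut n) (p i 1)).
Proof.
move=> m; exists (p i 1), (p i m.+2); split.
- by exists 0; exact: walk_nil.
- by exists m.+1; rewrite -[m.+2]add0n; have := ray_connected n i m.+1 0.
move=> [l lm /walk_contraction]; rewrite !pE expr1.
have [b0 _] := andP (base_bounds i).
have -> : (1 / 4 + d / 2 ^+ i) / 2 ^+ m.+2 = (1 / 4 + d / 2 ^+ i) / 2 / 2 ^+ m.+1.
  by rewrite exprS invfM mulrA.
move=> /(_ _)/wrap[|]; first by lra.
apply/negP; rewrite -ltNge ltr_pM2l; last by lra.
by rewrite ltf_pV2 ?posrE ?exprn_gt0// ltr_eXn2l// ltr1n.
Qed.

(** The component of [p j 1] has only [p j 1] in [(1/8, 1/4]], where [p i 1] lies. *)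
Lemma ray_component_inj n : set_inj `I_n (fun i => component_off (ray_cut n) (p i 1)).
Proof.
move=> i j; rewrite !inE => ni nj Kij.
have : component_off (ray_cut n) (p j 1) (p i 1).
  by rewrite -Kij; exists 0; exact: walk_nil.
move=> /(ray_component nj)[k _ /(congr1 (fun v => coord v))].
rewrite !pE expr1 => pji.
have k0 : k = 0%N.
  case: k pji => // k; rewrite !exprS !invfM => pji; exfalso; move: pji.
  by have := base_bounds i; have := base_bounds j; have := powV2_bounds R k; nra.
have d0 : d != 0 by case/andP: d4 => /gt_eqF ->.
move: pji; rewrite k0 expr1 => /(mulIf _)/addrI/(mulfI d0)/invr_inj ji.
by apply/esym/(@ieexprIn R 2); rewrite ?ltr0n ?pnatr_eq1// ji// invr_eq0.
Qed.

End Schreier.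

(** * Infinitely many ends *)

Local Open Scope ring_scope.
Local Open Scope ereal_scope.

Theorem corollary5p4 (R : realType) (x : R) (hx : (0 < x < 1)%R) :
  number_of_ends R (schreierF x) = +oo.
Proof.
have [d d4 rd] := reach_mid hx.
pose p i k : vertex (schreierF x) :=
  SigSub (mem_set (reach_orbit (reach_ray i k d4 rd))).
have pE i k : set_val (p i k) = ((1 / 4 + d / 2 ^+ i) / 2 ^+ k)%R by [].
apply: number_of_ends_pinfty => n; exists (ray_cut p n).
  by split; [exact: finite_image (finite_II n)|exact: finite_set0].
exists (fun i => component_off (ray_cut p n) (p i 1%N)).
  exact: ray_component_inj d4 pE n.
move=> i ni; split; last exact: ray_unbounded d4 pE n i.
by exists (p i 1%N) => //; exact: ray_cutN d4 pE n i 0%N.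
Qed.
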